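(* Let $f=f_{xxx}$ be a ternary cubic form with complex coefficients. The following are equivalent: (1) $f$ is completely reducible, i.e. $f=a_xb_xc_x$ for some linear forms $a_x,b_x,c_x$; (2) the Hessian $\Delta$ of $f$ is a multiple of $f$, i.e. $\Delta=\lambda f$ for some $\lambda\in\mathbb C$; (3) $\Pi=0$ (identically as a polynomial in $x$ and $u$); (4) $\Gamma=0$ (identically as a polynomial in $x$ and $u$).
   Context: All forms are homogeneous polynomials with complex coefficients in $x=(x_1,x_2,x_3)$, whose coefficients may also depend polynomially on auxiliary indeterminates $u=(u_1,u_2,u_3)$. For $a\in\mathbb C^3$ write $a_x=a_1x_1+a_2x_2+a_3x_3$, and $u_x=u_1x_1+u_2x_2+u_3x_3$. For forms $f,g,h$ and an integer $n\ge1$ the $n$-th transvectant is $J^n[f,g,h]=\big(\Omega^n(f(x)g(y)h(z))\big)\big|_{y=z=x}$, where $y,z$ are further triples of variables and $\Omega$ is the determinant of the $3\times3$ matrix of operators with rows $(\partial/\partial x_i)_i$, $(\partial/\partial y_i)_i$, $(\partial/\partial z_i)_i$. Equivalently, expand $\det(a,b,c)^n$ as a polynomial in the entries of $a,b,c$ and replace each monomial $a^\alpha b^\beta c^\gamma$ by $\partial^\alpha f\,\partial^\beta g\,\partial^\gamma h$, where all derivatives are with respect to $x$ and $u$ is treated as a constant. Write $J=J^1$. For a ternary cubic $f$ define $\Delta=\tfrac1{12}J^2[f,f,f]$; this is the Hessian, equal to $\tfrac12\det(\partial^2f/\partial x_i\partial x_j)$. Define also $\Pi=\tfrac1{12}J[\Delta,f,u_x]$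 (degree 4 in $x$, degree 1 in $u$) and $\Gamma=\tfrac1{432}J^3[\Pi,f,u_x^3]$ (degree 1 in $x$, degree 4 in $u$). *)

(* Defs.v *)
From HB Require Import structures.
From mathcomp Require Import all_boot all_algebra all_fingroup.
From mathcomp Require Import complex.
From mathcomp Require Import Rstruct.
From mathcomp.multinomials Require Import mpoly.

Set Implicit Arguments.
Unset Strict Implicit.
Unset Printing Implicit Defensive.

Import GRing.Theory.
Local Open Scope ring_scope.

Definition C : numClosedFieldType := complex Rdefinitions.R.

(* Polynomials in the 6 indeterminates x1 x2 x3 u1 u2 u3:
   variable (lshift 3 i) is x_(i+1), variable (rshift 3 i) is u_(i+1). *)
Definition xv (i : 'I_3) : 'I_6 := lshift 3 i.
Definition uv (i : 'I_3) : 'I_6 := rshift 3 i.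

Definition i0 : 'I_3 := @Ordinal 3 0 isT.
Definition i1 : 'I_3 := @Ordinal 3 1 isT.
Definition i2 : 'I_3 := @Ordinal 3 2 isT.

Definition embx (p : {mpoly C[3]}) : {mpoly C[6]} :=
  p \mPo [tuple 'X_(xv i) | i < 3].

Definition linform (a : 'I_3 -> C) : {mpoly C[3]} := \sum_(i < 3) a i *: 'X_i.

Definition ux : {mpoly C[6]} := \sum_(i < 3) 'X_(uv i) * 'X_(xv i).

Definition dx (l : seq 'I_3) (p : {mpoly C[6]}) : {mpoly C[6]} :=
  foldr (fun i q => q ^`M(xv i)) p l.

(* n-th transvectant J^n[f,g,h]: expand det(a,b,c)^n, where
   det(a,b,c) = sum_s sign(s) a_(s 0) b_(s 1) c_(s 2), as a sum over n-tuples
   of permutations, and replace a^al b^be c^ga by d^al f d^be g d^ga h. *)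
Definition transvectant (n : nat) (f g h : {mpoly C[6]}) : {mpoly C[6]} :=
  \sum_(s : {ffun 'I_n -> {perm 'I_3}})
    (\prod_(k < n) (-1) ^+ odd_perm (s k)) *:
     (dx [seq s k i0 | k <- enum 'I_n] f *
      dx [seq s k i1 | k <- enum 'I_n] g *
      dx [seq s k i2 | k <- enum 'I_n] h).

Definition Hess (f : {mpoly C[6]}) : {mpoly C[6]} :=
  (12%:R)^-1 *: transvectant 2 f f f.

Definition PiCov (f : {mpoly C[6]}) : {mpoly C[6]} :=
  (12%:R)^-1 *: transvectant 1 (Hess f) f ux.

Definition GammaCov (f : {mpoly C[6]}) : {mpoly C[6]} :=
  (432%:R)^-1 *: transvectant 3 (PiCov f) f (ux ^+ 3).

Definition completely_reducible (f : {mpoly C[3]}) : Prop :=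
  exists a b c : 'I_3 -> C, f = linform a * linform b * linform c.

(* Main.v *)
Require Import Defs.
From HB Require Import structures.
From mathcomp Require Import all_boot all_algebra all_fingroup.
From mathcomp Require Import complex.
From mathcomp Require Import Rstruct.
From mathcomp Require Import ring.
From mathcomp.multinomials Require Import mpoly.
Import GRing.Theory Num.Theory.
Local Open Scope ring_scope.

Set Implicit Arguments.
Unset Strict Implicit.
Unset Printing Implicit Defensive.

(** The implications (1) => (2) => (3) => (4) are formal: the Hessian of a product
    of three linear forms is the square of their determinant times the product,
    and Pi is a Jacobian that has proportional rows as soon as Delta = lambda f.

    For (4) => (1), restrict Gamma to the line u = (0,0,1) after a linear change
    of the variables x; by covariance the result vanishes again.  If the cubic
    meets the line z = 0 in three distinct points, coordinates can be chosen so
    that f = a x^2 y + b x y^2 + m xyz + p xz^2 + q yz^2 + c z^3 with a b <> 0, and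
    then Gamma (x; 0,0,1) is a nonzero multiple of p x + q y + c z; its vanishing
    leaves f = xy (a x + b y + m z).

    It remains to find such a line.  At a smooth zero with tangent z = 0 we have
    f = s x^2 z + x q(y,z) + k(y,z), and the line z = t y works when t <> 0 and
    q(1,t)^2 - 4 s t k(1,t) <> 0.  If this quartic in t vanishes identically, f is
    z times a square.  A cubic all of whose zeros are singular is a binary form. *)

(** * Transvectants as iterated determinants of derivations *)

Lemma sum_S3 (K : pzRingType) (V : lmodType K) (F : 'I_3 -> 'I_3 -> 'I_3 -> V) :
  \sum_(s : {perm 'I_3}) (-1) ^+ odd_perm s *: F (s i0) (s i1) (s i2) =
  F i0 i1 i2 - F i0 i2 i1 - F i1 i0 i2 + F i1 i2 i0 + F i2 i0 i1 - F i2 i1 i0.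
Proof.
pose t01 : {perm 'I_3} := tperm i0 i1; pose t02 : {perm 'I_3} := tperm i0 i2.
pose t12 : {perm 'I_3} := tperm i1 i2.
pose r := [:: 1%g; t12; t01; (t01 * t02)%g; (t02 * t01)%g; t02].
(* The images of [i0] and [i1] separate the six entries. As S_3 has six elements, the list is
   exhaustive. *)
have r_uniq : uniq r.
  apply: (@map_uniq _ _ (fun s : {perm 'I_3} => (s i0, s i1))).
  by rewrite /= !(perm1, permM, permE) /=.
have r_all s : s \in r.
  have [|| _ ->] := @uniq_min_size _ _ (enum {perm 'I_3}) r_uniq.
  - by move=> t _; rewrite mem_enum.
  - by rewrite -cardE card_Sn.
  - by rewrite mem_enum.
rewrite (perm_big r) /=; last first.
  by apply: uniq_perm; rewrite ?index_enum_uniq // => s; rewrite r_all mem_index_enum.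
rewrite !big_cons big_nil.
rewrite !odd_permM !odd_tperm odd_perm1 /= !(perm1, permM, permE) /=.
by rewrite !(expr0, expr1, scale1r, scaleN1r) addr0 !addrA.
Qed.

(** Partial derivatives commute, so the head of the list, which [foldr] applies last, may be applied
    first. *)
Lemma dx_cons l i p : dx (i :: l) p = dx l (p^`M(xv i)).
Proof. by elim: l => //= j l IH; rewrite -IH /= mderiv_comm. Qed.

(** An (n+1)-tuple of permutations is its first entry together with an n-tuple; the derivatives
    coming from the first entry are moved innermost, onto f, g and h. *)
Lemma transvectantS n f g h :
  transvectant n.+1 f g h =
  \sum_(s : {perm 'I_3}) (-1) ^+ odd_perm s *:
    transvectant n (f^`M(xv (s i0))) (g^`M(xv (s i1))) (h^`M(xv (s i2))).
Proof.
pose cons (p : {perm 'I_3} * {ffun 'I_n -> {perm 'I_3}}) : {ffun 'I_n.+1 -> {perm 'I_3}} :=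
  [ffun k => if unlift ord0 k is Some j then p.2 j else p.1].
have cons0 p : cons p ord0 = p.1 by rewrite ffunE unlift_none.
have consS p j : cons p (lift ord0 j) = p.2 j by rewrite ffunE liftK.
rewrite /transvectant (reindex cons) /=; last first.
  exists (fun s => (s ord0, [ffun j => s (lift ord0 j)])) => [[t s] _ | s _] /=.
    by rewrite cons0; congr pair; apply/ffunP => j; rewrite ffunE consS.
  by apply/ffunP => k; case: (unliftP ord0 k) => [j|] ->; rewrite ?consS ?cons0 /= ?ffunE.
rewrite (eq_bigr _ (fun _ _ => scaler_sumr _ _ _ _)) pair_big /=.
apply: eq_bigr => -[t s] _ /=.
rewrite big_ord_recl cons0 scalerA /=.
under eq_bigr => j _ do rewrite consS.
rewrite !enum_ordSl !map_cons -!map_comp !dx_cons !cons0 /=.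
congr (_ *: _).
by congr (dx _ _ * dx _ _ * dx _ _); apply: eq_map => k /=; rewrite consS.
Qed.

(** One factor of det(a,b,c)^n is expanded per step. Ring and operators are abstract, so that the
    same lemmas serve [{mpoly C[6]}] and [{mpoly C[3]}]. *)
Fixpoint trv (R : pzRingType) (D : 'I_3 -> R -> R) n (f g h : R) : R :=
  if n is n'.+1 then
    trv D n' (D i0 f) (D i1 g) (D i2 h) - trv D n' (D i0 f) (D i2 g) (D i1 h)
    - trv D n' (D i1 f) (D i0 g) (D i2 h) + trv D n' (D i1 f) (D i2 g) (D i0 h)
    + trv D n' (D i2 f) (D i0 g) (D i1 h) - trv D n' (D i2 f) (D i1 g) (D i0 h)
  else f * g * h.

Definition additive3 (R : pzRingType) (D : 'I_3 -> R -> R) :=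
  forall i f g, D i (f + g) = D i f + D i g.

Definition constant3 (R : pzRingType) (D : 'I_3 -> R -> R) (c : R) :=
  forall i f, D i (c * f) = c * D i f.

(** Three summands with constant coefficients are what the chain rule for a linear substitution
    produces. *)
Lemma trv_linear1 (R : comNzRingType) (D : 'I_3 -> R -> R) n c0 c1 c2 f0 f1 f2 g h :
  additive3 D -> constant3 D c0 -> constant3 D c1 -> constant3 D c2 ->
  trv D n (c0 * f0 + c1 * f1 + c2 * f2) g h =
  c0 * trv D n f0 g h + c1 * trv D n f1 g h + c2 * trv D n f2 g h.
Proof.
move=> DD D0 D1 D2; elim: n f0 f1 f2 g h => [|n IH] f0 f1 f2 g h /=; first by ring.
by rewrite !DD !D0 !D1 !D2 !IH; ring.
Qed.

Lemma trv_linear2 (R : comNzRingType) (D : 'I_3 -> R -> R) n c0 c1 c2 f g0 g1 g2 h :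
  additive3 D -> constant3 D c0 -> constant3 D c1 -> constant3 D c2 ->
  trv D n f (c0 * g0 + c1 * g1 + c2 * g2) h =
  c0 * trv D n f g0 h + c1 * trv D n f g1 h + c2 * trv D n f g2 h.
Proof.
move=> DD D0 D1 D2; elim: n f g0 g1 g2 h => [|n IH] f g0 g1 g2 h /=; first by ring.
by rewrite !DD !D0 !D1 !D2 !IH; ring.
Qed.

Lemma trv_linear3 (R : comNzRingType) (D : 'I_3 -> R -> R) n c0 c1 c2 f g h0 h1 h2 :
  additive3 D -> constant3 D c0 -> constant3 D c1 -> constant3 D c2 ->
  trv D n f g (c0 * h0 + c1 * h1 + c2 * h2) =
  c0 * trv D n f g h0 + c1 * trv D n f g h1 + c2 * trv D n f g h2.
Proof.
move=> DD D0 D1 D2; elim: n f g h0 h1 h2 => [|n IH] f g h0 h1 h2 /=; first by ring.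
by rewrite !DD !D0 !D1 !D2 !IH; ring.
Qed.

Lemma trv_scale1 (R : comNzRingType) (D : 'I_3 -> R -> R) n c f g h :
  additive3 D -> constant3 D c -> trv D n (c * f) g h = c * trv D n f g h.
Proof.
move=> DD Dc; have D0 : constant3 D 0.
  by move=> i x; rewrite !mul0r; apply: (addrI (D i 0)); rewrite -DD !addr0.
have := trv_linear1 n f 0 0 g h DD Dc D0 D0.
by rewrite !mul0r !addr0.
Qed.

Definition det3 (R : pzRingType) (a : 'I_3 -> 'I_3 -> R) : R :=
  a i0 i0 * a i1 i1 * a i2 i2 - a i0 i0 * a i1 i2 * a i2 i1
  - a i0 i1 * a i1 i0 * a i2 i2 + a i0 i1 * a i1 i2 * a i2 i0
  + a i0 i2 * a i1 i0 * a i2 i1 - a i0 i2 * a i1 i1 * a i2 i0.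

(* Covariance of the transvectants, with [phi] a substitution and [a] its Jacobian matrix. *)
Lemma trv_morph (R S : comNzRingType) (D : 'I_3 -> R -> R) (E : 'I_3 -> S -> S)
    (phi : {rmorphism R -> S}) (a : 'I_3 -> 'I_3 -> S) n f g h :
  additive3 E -> (forall j i, constant3 E (a j i)) ->
  (forall i p, E i (phi p) = a i0 i * phi (D i0 p) + a i1 i * phi (D i1 p) + a i2 i * phi (D i2 p)) ->
  trv E n (phi f) (phi g) (phi h) = det3 a ^+ n * phi (trv D n f g h).
Proof.
move=> DE Ea Ephi; elim: n f g h => [|n IH] f g h /=.
  by rewrite expr0 mul1r !rmorphM.
rewrite !Ephi.
(* Each of the six terms splits into 27 by trilinearity. Those with a repeated derivation cancel,
   and the rest collect into [det3 a] times the six terms for [D]. *)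
do !rewrite [trv E n (_ + _) _ _]trv_linear1 //.
do !rewrite [trv E n _ (_ + _) _]trv_linear2 //.
do !rewrite [trv E n _ _ (_ + _)]trv_linear3 //.
rewrite !IH !(rmorphD, rmorphB, rmorphN) /= exprSr /det3.
set d := (X in X ^+ n); move: (d ^+ n) => dn.
ring.
Qed.

(** * The covariant Gamma of a cubic with three known collinear zeros *)

(* [Gamma] without its numerical factors, [u] standing for the form [u_x]. *)
Definition gamma3 (R : pzRingType) (D : 'I_3 -> R -> R) (f u : R) : R :=
  trv D 3 (trv D 1 (trv D 2 f f f) f u) f (u ^+ 3).

Definition derivation3 (R : pzRingType) (D : 'I_3 -> R -> R) :=
  additive3 D /\ forall i f g, D i (f * g) = D i f * g + f * D i g.

Lemma derivation3N (R : comNzRingType) (D : 'I_3 -> R -> R) i f :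
  derivation3 D -> D i (- f) = - D i f.
Proof.
move=> [DD DM]; have D0 : D i 0 = 0 by apply: (addrI (D i 0)); rewrite -DD !addr0.
by apply: (addrI (D i f)); rewrite -DD !subrr.
Qed.

Lemma derivation3_1 (R : comNzRingType) (D : 'I_3 -> R -> R) i :
  derivation3 D -> D i 1 = 0.
Proof.
by move=> [_ DM]; apply: (addrI (D i 1)); rewrite addr0 -{3}[1]mulr1 DM mulr1 mul1r.
Qed.

Lemma derivation3X (R : comNzRingType) (D : 'I_3 -> R -> R) i f n :
  derivation3 D -> D i (f ^+ n.+1) = n.+1%:R * f ^+ n * D i f.
Proof.
move=> dD; have DM := dD.2; elim: n => [|n IH]; first by rewrite expr1 expr0; ring.
by rewrite exprS DM IH !exprS -[n.+2%:R]natr1; ring.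
Qed.

Lemma trv0E (R : pzRingType) (D : 'I_3 -> R -> R) f g h : trv D 0 f g h = f * g * h.
Proof. by []. Qed.

(** Only the two permutations that put [D i2] on h survive, which leaves a binary Jacobian in [D i0]
    and [D i1]. *)
Lemma trv_binary (R : comNzRingType) (D : 'I_3 -> R -> R) n f g h :
  additive3 D -> D i0 h = 0 -> D i1 h = 0 ->
  trv D n.+1 f g h = trv D n (D i0 f) (D i1 g) (D i2 h) - trv D n (D i1 f) (D i0 g) (D i2 h).
Proof.
move=> DD h0 h1; have D0 i : D i 0 = 0 by apply: (addrI (D i 0)); rewrite -DD !addr0.
have trv0 k f' g' : trv D k f' g' 0 = 0.
  by elim: k f' g' => [|k IH] f' g' /=; rewrite ?mulr0 // !D0 !IH !(subr0, addr0).
by rewrite /= h0 h1 !trv0 !(subr0, addr0, add0r).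
Qed.

Lemma derivation3_nat (R : comNzRingType) (D : 'I_3 -> R -> R) i n :
  derivation3 D -> D i n%:R = 0.
Proof.
move=> dD; have [DD _] := dD; have D0 : D i 0 = 0 by apply: (addrI (D i 0)); rewrite -DD !addr0.
by elim: n => [|n IH] //; rewrite -natr1 DD IH derivation3_1 // addr0.
Qed.

Lemma derivation3_natM (R : comNzRingType) (D : 'I_3 -> R -> R) i n f :
  derivation3 D -> D i (n%:R * f) = n%:R * D i f.
Proof. by move=> dD; rewrite dD.2 derivation3_nat // mul0r add0r. Qed.

(** * Forms given by coefficient lists, and their derivatives *)

Definition coordinates3 (R : pzRingType) (D : 'I_3 -> R -> R) (t : 'I_3 -> R) :=
  forall i j, D i (t j) = (i == j)%:R.

(* Coefficients are listed in the order xxx, xxy, xxz, xyy, xyz, xzz, yyy, yyz, yzz, zzz, and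
   those of [quadric] in the order xx, xy, xz, yy, yz, zz; missing entries count as 0. *)
Definition cubic (R : pzRingType) (c : seq R) (t : 'I_3 -> R) : R :=
  let x := t i0 in let y := t i1 in let z := t i2 in
  c`_0 * x * x * x + c`_1 * x * x * y + c`_2 * x * x * z + c`_3 * x * y * y + c`_4 * x * y * z
  + c`_5 * x * z * z + c`_6 * y * y * y + c`_7 * y * y * z + c`_8 * y * z * z + c`_9 * z * z * z.

Definition quadric (R : pzRingType) (c : seq R) (t : 'I_3 -> R) : R :=
  let x := t i0 in let y := t i1 in let z := t i2 in
  c`_0 * x * x + c`_1 * x * y + c`_2 * x * z + c`_3 * y * y + c`_4 * y * z + c`_5 * z * z.

Definition linear3 (R : pzRingType) (c : seq R) (t : 'I_3 -> R) : R :=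
  c`_0 * t i0 + c`_1 * t i1 + c`_2 * t i2.

Definition dcubic (R : pzRingType) (i : 'I_3) (c : seq R) : seq R :=
  match val i with
  | 0 => [:: 3%:R * c`_0; 2%:R * c`_1; 2%:R * c`_2; c`_3; c`_4; c`_5]
  | 1 => [:: c`_1; 2%:R * c`_3; c`_4; 3%:R * c`_6; 2%:R * c`_7; c`_8]
  | _ => [:: c`_2; c`_4; 2%:R * c`_5; c`_7; 2%:R * c`_8; 3%:R * c`_9]
  end.

Definition dquadric (R : pzRingType) (i : 'I_3) (c : seq R) : seq R :=
  match val i with
  | 0 => [:: 2%:R * c`_0; c`_1; c`_2]
  | 1 => [:: c`_1; 2%:R * c`_3; c`_4]
  | _ => [:: c`_2; c`_4; 2%:R * c`_5]
  end.

Definition constants3 (R : pzRingType) (D : 'I_3 -> R -> R) (c : seq R) :=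
  forall i k, D i c`_k = 0.

Lemma constants3_dcubic (R : comNzRingType) (D : 'I_3 -> R -> R) i c :
  derivation3 D -> constants3 D c -> constants3 D (dcubic i c).
Proof.
move=> dD Dc j k; have D0 : D j 0 = 0 by rewrite (derivation3_nat j 0 dD).
by rewrite /dcubic; case: (val i) => [|[|?]]; do 6?[case: k => [|k] /=];
  rewrite ?derivation3_natM ?Dc ?mulr0 // nth_nil.
Qed.

Lemma constants3_dquadric (R : comNzRingType) (D : 'I_3 -> R -> R) i c :
  derivation3 D -> constants3 D c -> constants3 D (dquadric i c).
Proof.
move=> dD Dc j k; have D0 : D j 0 = 0 by rewrite (derivation3_nat j 0 dD).
by rewrite /dquadric; case: (val i) => [|[|?]]; do 3?[case: k => [|k] /=];
  rewrite ?derivation3_natM ?Dc ?mulr0 // nth_nil.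
Qed.

Lemma linear3_deriv (R : comNzRingType) (D : 'I_3 -> R -> R) t c i :
  derivation3 D -> coordinates3 D t -> constants3 D c -> D i (linear3 c t) = c`_i.
Proof.
move=> [DD DM] Dt Dc; rewrite /linear3 !DD !DM !Dc !Dt.
by case: i => -[|[|[|//]]] ?; rewrite /= ?mulr0n ?mulr1n; ring.
Qed.

Lemma quadric_deriv (R : comNzRingType) (D : 'I_3 -> R -> R) t c i :
  derivation3 D -> coordinates3 D t -> constants3 D c ->
  D i (quadric c t) = linear3 (dquadric i c) t.
Proof.
move=> [DD DM] Dt Dc; rewrite /quadric !DD !DM !Dc !Dt /linear3 /dquadric.
by case: i => -[|[|[|//]]] ?; rewrite /= ?mulr0n ?mulr1n; ring.
Qed.

Lemma cubic_deriv (R : comNzRingType) (D : 'I_3 -> R -> R) t c i :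
  derivation3 D -> coordinates3 D t -> constants3 D c ->
  D i (cubic c t) = quadric (dcubic i c) t.
Proof.
move=> [DD DM] Dt Dc; rewrite /cubic !DD !DM !Dc !Dt /quadric /dcubic.
by case: i => -[|[|[|//]]] ?; rewrite /= ?mulr0n ?mulr1n; ring.
Qed.

(** Each of the six permutations of the first step contributes one Leibniz expansion of the
    determinant of h, whence the factor 6. *)
Lemma trv2_hessian (R : comNzRingType) (D : 'I_3 -> R -> R) f (h : 'I_3 -> 'I_3 -> R) :
  (forall i j, D i (D j f) = h i j) -> (forall i j, h i j = h j i) ->
  trv D 2 f f f = 6%:R * det3 h.
Proof.
move=> fh hC; rewrite /= !fh /det3.
by rewrite (hC i1 i0) (hC i2 i0) (hC i2 i1); ring.
Qed.

(** The cubic is xy(ax + by + mz) + z^2(px + qy + cz). The list holds the coefficients of its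
    Hessian Delta, half the determinant of the second derivatives. *)
Lemma trv2_triangle (R : comNzRingType) (D : 'I_3 -> R -> R) t (a b m p q c : R) :
  derivation3 D -> coordinates3 D t ->
  let f := cubic [:: 0; a; 0; b; m; p; 0; 0; q; c] t in
  constants3 D [:: 0; a; 0; b; m; p; 0; 0; q; c] ->
  trv D 2 f f f = 12%:R * cubic
   [:: - (4%:R * a ^+ 2 * p); a * m ^+ 2 - 4%:R * a ^+ 2 * q - 4%:R * a * b * p;
       - (12%:R * a ^+ 2 * c); b * m ^+ 2 - 4%:R * a * b * q - 4%:R * b ^+ 2 * p;
       m ^+ 3 - 12%:R * a * b * c - 4%:R * a * m * q - 4%:R * b * m * p;
       m ^+ 2 * p - 12%:R * a * m * c + 8%:R * a * p * q - 4%:R * b * p ^+ 2;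
       - (4%:R * b ^+ 2 * q); - (12%:R * b ^+ 2 * c);
       m ^+ 2 * q - 4%:R * a * q ^+ 2 - 12%:R * b * m * c + 8%:R * b * p * q;
       4%:R * m * p * q - 3%:R * m ^+ 2 * c] t.
Proof.
move=> dD Dt f; set cf := [:: 0; a; 0; b; m; p; 0; 0; q; c] => Dc.
pose h i j := linear3 (dquadric i (dcubic j cf)) t.
have fh i j : D i (D j f) = h i j.
  rewrite (cubic_deriv _ dD Dt Dc) (quadric_deriv _ dD Dt) //.
  exact: constants3_dcubic.
rewrite (trv2_hessian fh) /det3 => [|i j].
  by rewrite /h /linear3 /cubic /=; ring.
case: i => -[|[|[|//]]] ?; case: j => -[|[|[|//]]] ?; rewrite /h /linear3 /=; ring.
Qed.

Lemma derivationB (R : comNzRingType) (D : 'I_3 -> R -> R) i f g :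
  derivation3 D -> D i (f - g) = D i f - D i g.
Proof. by move=> dD; rewrite dD.1 derivation3N. Qed.

Lemma leibniz3 (R : comNzRingType) (D : 'I_3 -> R -> R) i j k f g :
  derivation3 D ->
  D i (D j (D k (f * g))) =
    D i (D j (D k f)) * g + D j (D k f) * D i g + D i (D k f) * D j g + D i (D j f) * D k g
    + D k f * D i (D j g) + D j f * D i (D k g) + D i f * D j (D k g) + f * D i (D j (D k g)).
Proof. by move=> [DD DM]; do 6!rewrite ?DM ?DD; ring. Qed.

(** As z is killed by [D i0] and [D i1], this is the third binary transvectant in these two
    derivations; the factor 6 is the third derivative of z^3. *)
Lemma trv3_cube (R : comNzRingType) (D : 'I_3 -> R -> R) f g z :
  derivation3 D -> D i0 z = 0 -> D i1 z = 0 -> D i2 z = 1 ->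
  let D3 i j k h := D i (D j (D k h)) in
  trv D 3 f g (z ^+ 3) = 6%:R *
    (D3 i0 i0 i0 f * D3 i1 i1 i1 g
     - D3 i1 i0 i0 f * D3 i0 i1 i1 g - D3 i0 i1 i0 f * D3 i1 i0 i1 g - D3 i0 i0 i1 f * D3 i1 i1 i0 g
     + D3 i0 i1 i1 f * D3 i1 i0 i0 g + D3 i1 i0 i1 f * D3 i0 i1 i0 g + D3 i1 i1 i0 f * D3 i0 i0 i1 g
     - D3 i1 i1 i1 f * D3 i0 i0 i0 g).
Proof.
move=> dD z0 z1 z2 D3.
have DX3 i : D i (z ^+ 3) = 3%:R * z ^+ 2 * D i z by rewrite derivation3X.
have DX2 i : D i (3%:R * z ^+ 2) = 6%:R * z * D i z by rewrite derivation3_natM // derivation3X //; ring.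
have DX1 i : D i (6%:R * z) = 6%:R * D i z by rewrite derivation3_natM.
have DD := dD.1.
rewrite trv_binary // ?DX3 ?z0 ?z1 ?z2 ?mulr0 // mulr1.
rewrite !(@trv_binary _ _ 1) // ?DX2 ?z0 ?z1 ?z2 ?mulr0 // mulr1.
rewrite !(@trv_binary _ _ 0) // ?DX1 ?z0 ?z1 ?z2 ?mulr0 // mulr1 /= /D3.
ring.
Qed.

(** Since 72 * 864 = 12 * 12 * 432, the normalized covariant at u = (0,0,1) is exactly (ab)^2 (px +
    qy + cz). *)
Lemma gamma3_triangle (R : comNzRingType) (D : 'I_3 -> R -> R) t (a b m p q c : R) :
  derivation3 D -> coordinates3 D t -> (forall i e, e \in [:: a; b; m; p; q; c] -> D i e = 0) ->
  gamma3 D (cubic [:: 0; a; 0; b; m; p; 0; 0; q; c] t) (t i2)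
   = 72%:R * 864%:R * (a * b) ^+ 2 * (p * t i0 + q * t i1 + c * t i2).
Proof.
move=> dD Dt Dabc; have [DD DM] := dD.
have D0 i : D i 0 = 0 by rewrite (derivation3_nat i 0 dD).
have Da i : D i a = 0 by rewrite Dabc // !inE eqxx ?orbT.
have Db i : D i b = 0 by rewrite Dabc // !inE eqxx ?orbT.
have Dm i : D i m = 0 by rewrite Dabc // !inE eqxx ?orbT.
have Dp i : D i p = 0 by rewrite Dabc // !inE eqxx ?orbT.
have Dq i : D i q = 0 by rewrite Dabc // !inE eqxx ?orbT.
have Dc i : D i c = 0 by rewrite Dabc // !inE eqxx ?orbT.
(* The elements killed by every [D i] form a subring, so the coefficients of the Hessian are
   constants as well. *)
have Dn n i : D i n%:R = 0 by apply: derivation3_nat.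
have DN i e : D i e = 0 -> D i (- e) = 0 by move=> De; rewrite derivation3N // De oppr0.
have DP i e e' : D i e = 0 -> D i e' = 0 -> D i (e + e') = 0 by move=> De De'; rewrite DD De De' addr0.
have DMM i e e' : D i e = 0 -> D i e' = 0 -> D i (e * e') = 0.
  by move=> De De'; rewrite DM De De' mul0r mulr0 addr0.
have DX i e n : D i e = 0 -> D i (e ^+ n) = 0.
  by move=> De; elim: n => [|n IH]; rewrite ?exprS ?DMM // expr0 (Dn 1%N).
set cf := [:: 0; a; 0; b; m; p; 0; 0; q; c].
have Dcf : constants3 D cf.
  by move=> i k; do 10?[case: k => [|k] //=]; rewrite nth_nil.
have := trv2_triangle dD Dt Dcf; rewrite -/cf; set cD := (X in _ * cubic X _) => EDelta.
have DcD : constants3 D cD.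
  move=> i k; do 10?[case: k => [|k] /=]; rewrite ?nth_nil //;
  by do ?[exact: (Dn) | exact: (Da) | exact: (Db) | exact: (Dm) | exact: (Dp) | exact: (Dq) | exact: (Dc)
    | apply: (DN) | apply: (DMM) | apply: (DX) | apply: (DP)].
have z0 : D i0 (t i2) = 0 by rewrite Dt.
have z1 : D i1 (t i2) = 0 by rewrite Dt.
have z2 : D i2 (t i2) = 1 by rewrite Dt.
rewrite /gamma3 EDelta.
have C12 : constant3 D 12%:R by move=> i g; apply: derivation3_natM.
(* Naming the derivatives by variables keeps the rewrites below from unfolding [cubic]. *)
have jets c' : constants3 D c' -> exists g g1 g2 g3,
    [/\ g = cubic c' t,
        (forall i, g1 i = quadric (dcubic i c') t) /\ (forall i, D i g = g1 i),
        (forall i j, g2 i j = linear3 (dquadric i (dcubic j c')) t) /\ (forall i j, D i (g1 j) = g2 i j),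
        (forall i j k, g3 i j k = (dquadric j (dcubic k c'))`_i) /\ (forall i j k, D i (g2 j k) = g3 i j k)
      & forall l i j k, D l (g3 i j k) = 0].
  move=> Dc'.
  exists (cubic c' t), (fun i => quadric (dcubic i c') t), (fun i j => linear3 (dquadric i (dcubic j c')) t),
    (fun i j k => (dquadric j (dcubic k c'))`_i).
  split=> [//|||| l i j k]; last by apply: constants3_dquadric => //; apply: constants3_dcubic.
  - by split=> // i; apply: cubic_deriv.
  - by split=> // i j; apply: quadric_deriv => //; apply: constants3_dcubic.
  - by split=> // i j k; apply: linear3_deriv => //; apply/constants3_dquadric/constants3_dcubic.
have [f [f1 [f2 [f3 [<- [F1 Df] [F2 Df1] [F3 Df2] Df3]]]]] := jets _ Dcf.
have [g [g1 [g2 [g3 [<- [G1 Dg] [G2 Dg1] [G3 Dg2] Dg3]]]]] := jets _ DcD.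
(* With u_x = z, the inner transvectant is the binary Jacobian of Delta and f. Its third derivatives
   follow from the Leibniz rule, where fourth derivatives of the cubics vanish. *)
rewrite !trv_scale1 // [trv D 1 _ _ _]trv_binary // !trv0E !z2 !mulr1.
rewrite trv3_cube // !(derivationB _ _ _ dD) !(leibniz3 _ _ _ _ _ dD).
rewrite !Df !Dg !Df1 !Dg1 !Df2 !Dg2 !Df3 !Dg3.
rewrite !F1 !G1 !F2 !G2 !F3 !G3 /quadric /linear3 /=.
ring.
Qed.

Lemma mpolyX_deriv_self n (R : nzRingType) (i : 'I_n) : ('X_i : {mpoly R[n]})^`M(i) = 1.
Proof.
rewrite mderivX mnm1E eqxx scale1r (_ : _ - _ = 0)%MM ?mpolyX0 //.
by apply/mnmP => j; rewrite mnmBE subnn mnm0E.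
Qed.

(** * Linear substitutions *)

(** Constants and variables generate the polynomial ring, so identities compatible with sums and
    products need checking only there. *)
Lemma mpoly_ring_ind n (R : comNzRingType) (P : {mpoly R[n]} -> Prop) :
  (forall c, P c%:MP) -> (forall i, P 'X_i) ->
  (forall p q, P p -> P q -> P (p + q)) -> (forall p q, P p -> P q -> P (p * q)) ->
  forall p, P p.
Proof.
move=> PC PX PD PM p; rewrite (mpolyE p).
elim/big_ind: _ => [||m _]; [by rewrite -mpolyC0 | exact: (PD) |].
rewrite -mul_mpolyC; apply: (PM) => //; rewrite mpolyXE_id.
elim/big_ind: _ => [||i _]; [by rewrite -mpolyC1 | exact: (PM) |].
by elim: (m i) => [|k IH]; [rewrite expr0 -mpolyC1 | rewrite exprS; apply: (PM)].
Qed.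

Lemma comp_mpolyA n k l (R : comNzRingType) (s : n.-tuple {mpoly R[k]})
    (r : k.-tuple {mpoly R[l]}) p :
  (p \mPo s) \mPo r = p \mPo [tuple tnth s i \mPo r | i < n].
Proof.
elim/mpoly_ring_ind: p => [c|i|p q IHp IHq|p q IHp IHq].
- by rewrite !comp_mpolyC.
- by rewrite !comp_mpolyXU -!tnth_nth tnth_mktuple.
- by rewrite !comp_mpolyD IHp IHq.
- by rewrite !rmorphM /= IHp IHq.
Qed.

Lemma mderiv_comp n k (R : comNzRingType) (s : n.-tuple {mpoly R[k]}) p i :
  (p \mPo s)^`M(i) = \sum_(j < n) (p^`M(j) \mPo s) * (tnth s j)^`M(i).
Proof.
elim/mpoly_ring_ind: p => [c|l|p q IHp IHq|p q IHp IHq].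
- rewrite comp_mpolyC mderivC big1 // => j _.
  by rewrite mderivC comp_mpoly0 mul0r.
- rewrite comp_mpolyXU -tnth_nth (bigD1 l) //= big1 => [|j jl].
    by rewrite mpolyX_deriv_self comp_mpoly1 mul1r addr0.
  by rewrite mderivX mnm1E eq_sym (negPf jl) scale0r comp_mpoly0 mul0r.
- rewrite comp_mpolyD mderivD IHp IHq -big_split; apply: eq_bigr => j _ /=.
  by rewrite mderivD comp_mpolyD mulrDl.
- rewrite rmorphM mderivM IHp IHq mulr_suml mulr_sumr -big_split.
  apply: eq_bigr => j _ /=.
  by rewrite mderivM comp_mpolyD !rmorphM /= mulrDl; ring.
Qed.

Lemma sum3 (V : nmodType) (F : 'I_3 -> V) : \sum_(i < 3) F i = F i0 + F i1 + F i2.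
Proof.
rewrite !big_ord_recl big_ord0 addr0 addrA.
by congr (F _ + F _ + F _); apply: val_inj.
Qed.

Lemma transvectantE n f g h : transvectant n f g h = trv (fun i p => p^`M(xv i)) n f g h.
Proof.
elim: n f g h => [|n IH] f g h.
  (* For n = 0 the sum has a single term, the function on the empty type. *)
  rewrite /transvectant (bigD1 [ffun=> 1%g]) //= [X in _ + X]big1 => [|s].
    by rewrite big_ord0 scale1r addr0 enum_ord0.
  by rewrite (_ : s == _) //; apply/eqP/ffunP => -[].
rewrite transvectantS.
by rewrite (sum_S3 (fun i j k => transvectant n f^`M(xv i) g^`M(xv j) h^`M(xv k))) !IH.
Qed.

Lemma linform_mderiv a i : (linform a)^`M(i) = (a i)%:MP.
Proof.
rewrite /linform raddf_sum (bigD1 i) //= big1 => [|j ji].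
  by rewrite mderivZ mpolyX_deriv_self addr0 alg_mpolyC.
by rewrite mderivZ mderivX mnm1E (negPf ji) scale0r scaler0.
Qed.

Definition lsub (A : 'M[C]_3) : 3.-tuple {mpoly C[3]} := [tuple linform (A j) | j < 3].

(* x goes to A x, and u to the constant vector v. *)
Definition xu_sub (A : 'M[C]_3) (v : 'I_3 -> C) : 6.-tuple {mpoly C[3]} :=
  [tuple match split (k : 'I_(3 + 3)) with
         | inl j => linform (A j)
         | inr j => (v j)%:MP
         end | k < 6].

Lemma tnth_xu_sub_x A v j : tnth (xu_sub A v) (xv j) = linform (A j).
Proof. by rewrite tnth_mktuple (unsplitK (inl j)). Qed.

Lemma tnth_xu_sub_u A v j : tnth (xu_sub A v) (uv j) = (v j)%:MP.
Proof. by rewrite tnth_mktuple (unsplitK (inr j)). Qed.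

Lemma embx_xu_sub A v f : embx f \mPo xu_sub A v = f \mPo lsub A.
Proof.
rewrite /embx comp_mpolyA.
suff -> : [tuple tnth [tuple 'X_(xv i) | i < 3] i \mPo xu_sub A v | i < 3] = lsub A by [].
apply: eq_from_tnth => j; rewrite !tnth_mktuple comp_mpolyXU -tnth_nth.
exact: tnth_xu_sub_x.
Qed.

Lemma mderiv_xu_sub A v i p :
  (p \mPo xu_sub A v)^`M(i) = (A i0 i)%:MP * (p^`M(xv i0) \mPo xu_sub A v)
    + (A i1 i)%:MP * (p^`M(xv i1) \mPo xu_sub A v) + (A i2 i)%:MP * (p^`M(xv i2) \mPo xu_sub A v).
Proof.
rewrite mderiv_comp (@big_split_ord _ _ _ 3 3) /= [X in _ + X]big1 => [|j _]; last first.
  by rewrite (tnth_xu_sub_u A v j) mderivC mulr0.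
rewrite addr0 sum3 !(tnth_xu_sub_x A v) !linform_mderiv.
by congr (_ + _ + _); apply: mulrC.
Qed.

Lemma ux_xu_sub A v : ux \mPo xu_sub A v = linform (fun j => \sum_i v i * A i j).
Proof.
rewrite /ux raddf_sum /= /linform.
under eq_bigr => i _ do
  rewrite rmorphM /= !comp_mpolyXU -!tnth_nth tnth_xu_sub_x tnth_xu_sub_u mulr_sumr.
rewrite exchange_big; apply: eq_bigr => j _ /=.
by rewrite scaler_suml; apply: eq_bigr => i _; rewrite mul_mpolyC scalerA.
Qed.

Lemma GammaCov_gamma3 F :
  GammaCov F = 0 -> gamma3 (fun i p => p^`M(xv i)) F ux = 0.
Proof.
rewrite /GammaCov /PiCov /Hess !transvectantE /gamma3.
rewrite -![_^-1 *: _]mul_mpolyC.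
have DD : additive3 (fun i (p : {mpoly C[6]}) => p^`M(xv i)) by move=> i p q; apply: mderivD.
have Dc c : constant3 (fun i (p : {mpoly C[6]}) => p^`M(xv i)) c%:MP by move=> i p; apply: mderiv_mulC.
have cancelC (k : C) (p : {mpoly C[6]}) : k != 0 -> k%:MP * p = 0 -> p = 0.
  by move=> k0 /eqP; rewrite mul_mpolyC scaler_eq0 (negPf k0) => /eqP.
rewrite !trv_scale1 // => /cancelC; rewrite invr_eq0 pnatr_eq0 => /(_ isT).
by do 2![move/cancelC; rewrite invr_eq0 pnatr_eq0 => /(_ isT)].
Qed.

(** By covariance the three transvectants contribute the powers 2, 1 and 3 of the determinant of A,
    so the transformed value is a multiple of the substituted original. *)
Lemma gamma3_lsub f (A : 'M[C]_3) : A \in unitmx ->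
  GammaCov (embx f) = 0 -> gamma3 (fun i p => p^`M(i)) (f \mPo lsub A) 'X_i2 = 0.
Proof.
move=> uA /GammaCov_gamma3 G0.
(* The last row v of the inverse satisfies v A = (0,0,1), so u_x is sent to z. *)
pose v i := invmx A i2 i; pose phi := xu_sub A v.
have -> : 'X_i2 = ux \mPo phi.
  rewrite ux_xu_sub; have vA j : \sum_i v i * A i j = (i2 == j)%:R.
    by have := congr1 (fun M : 'M[C]_3 => M i2 j) (mulVmx uA); rewrite !mxE.
  rewrite /linform (bigD1 i2) //= [X in _ + X]big1 => [|j ji].
    by rewrite vA eqxx scale1r addr0.
  by rewrite vA eq_sym (negPf ji) scale0r.
rewrite -(embx_xu_sub A v) -/phi.
pose D i (p : {mpoly C[6]}) := p^`M(xv i); pose E i (p : {mpoly C[3]}) := p^`M(i).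
have DE : additive3 E by move=> i p q; apply: mderivD.
have Ec c : constant3 E c%:MP by move=> i p; apply: mderiv_mulC.
pose a j i := (A j i)%:MP : {mpoly C[3]}.
have Ephi n f' g' h' : trv E n (f' \mPo phi) (g' \mPo phi) (h' \mPo phi)
    = det3 a ^+ n * (trv D n f' g' h' \mPo phi).
  apply: (@trv_morph {mpoly C[6]} {mpoly C[3]} D E (comp_mpoly phi) a) => [//|j i|i p]; [exact: Ec | exact: mderiv_xu_sub].
have [d Ed] : exists d, det3 a = d%:MP.
  exists (det3 (fun j i => A j i)).
  by rewrite /det3 !(mpolyCD, mpolyCB, mpolyCM, mpolyCN).
have Edn n : det3 a ^+ n = (d ^+ n)%:MP by rewrite Ed rmorphXn.
have ux3 : (ux \mPo phi) ^+ 3 = (ux ^+ 3) \mPo phi by rewrite rmorphXn.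
rewrite -/E /gamma3 ux3 (Ephi 2 (embx f)) Edn (trv_scale1 1 _ _ _ DE (Ec _)).
rewrite (Ephi 1 (trv D 2 _ _ _)) Edn !(trv_scale1 3 _ _ _ DE (Ec _)) (Ephi 3 (trv D 1 _ _ _)).
have -> : trv D 3 (trv D 1 (trv D 2 (embx f) (embx f) (embx f)) (embx f) ux) (embx f) (ux ^+ 3) = 0 by exact: G0.
by rewrite comp_mpoly0 !mulr0.
Qed.

(** * Coefficients of a transformed cubic *)

Lemma quadratic_root (F : closedFieldType) (a b c : F) :
  a != 0 -> exists r, a * r ^+ 2 + b * r + c = 0.
Proof.
(* [solve_monicpoly] solves x^n = sum of P_i x^i for i < n, hence the division by a and the sign. *)
move=> a0; have [r Er] := solve_monicpoly (fun i => - [:: c / a; b / a]`_i) (isT : (0 < 2)%N).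
exists r; rewrite Er !big_ord_recl big_ord0 /=.
by rewrite /bump /= expr0 expr1; field.
Qed.

Lemma cubic_root (F : closedFieldType) (a b c d : F) :
  a != 0 -> exists r, a * r ^+ 3 + b * r ^+ 2 + c * r + d = 0.
Proof.
move=> a0; have [r Er] := solve_monicpoly (fun i => - [:: d / a; c / a; b / a]`_i) (isT : (0 < 3)%N).
exists r; rewrite Er !big_ord_recl big_ord0 /=.
by rewrite /bump /= expr0 expr1; field.
Qed.

(** This factors the binary form a y^2 + b yz + c z^2 as (py + qz)(ry + sz). *)
Lemma quadratic_split (F : closedFieldType) (a b c : F) :
  exists p q r s, [/\ a = p * r, b = p * s + q * r & c = q * s].
Proof.
have [-> | a0] := eqVneq a 0; first by exists 0, 1, b, c; split; ring.
have [r Er] := quadratic_root b c a0.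
exists 1, (- r), a, (b + a * r); split; [ring | ring |].
by apply/eqP; rewrite -subr_eq0 -Er; apply/eqP; ring.
Qed.

Definition point (F : pzRingType) (s : seq F) : 'I_3 -> F := fun i => s`_i.

(** The derivative at P in the direction Q, which is the coefficient of x^2 y in f (x P + y Q). *)
Definition deriv_at (F : pzRingType) (c : seq F) (P Q : 'I_3 -> F) : F :=
  linear3 [:: quadric (dcubic i0 c) P; quadric (dcubic i1 c) P; quadric (dcubic i2 c) P] Q.

(** The third derivative in the directions P, Q and W, which is the coefficient of xyz in f (x P + y
    Q + z W). *)
Definition polar (F : pzRingType) (c : seq F) (P Q W : 'I_3 -> F) : F :=
  let l i := linear3 [:: linear3 (dquadric i (dcubic i0 c)) W; linear3 (dquadric i (dcubic i1 c)) W;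
                         linear3 (dquadric i (dcubic i2 c)) W] P in
  linear3 [:: l i0; l i1; l i2] Q.

(* Coefficients of f (x P + y Q + z W), where P, Q and W are the columns of A. *)
Definition csub (F : pzRingType) (c : seq F) (A : 'I_3 -> 'I_3 -> F) : seq F :=
  let P := A^~ i0 in let Q := A^~ i1 in let W := A^~ i2 in
  [:: cubic c P; deriv_at c P Q; deriv_at c P W; deriv_at c Q P; polar c P Q W;
      deriv_at c W P; cubic c Q; deriv_at c Q W; deriv_at c W Q; cubic c W].

Lemma cubic_csub (F : comNzRingType) (c : seq F) A t :
  cubic c (fun j => linear3 [:: A j i0; A j i1; A j i2] t) = cubic (csub c A) t.
Proof.
rewrite /csub /cubic /deriv_at /polar /quadric /linear3 /=.
move: (A i0 i0) (A i0 i1) (A i0 i2) (A i1 i0) (A i1 i1) (A i1 i2) (A i2 i0) (A i2 i1) (A i2 i2).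
by move=> *; ring.
Qed.

Lemma nth_map_rmorph (R S : pzRingType) (phi : {rmorphism R -> S}) (c : seq R) k :
  (map phi c)`_k = phi c`_k.
Proof.
have [kc | kc] := ltnP k (size c); first by rewrite (nth_map 0).
by rewrite !nth_default ?size_map // rmorph0.
Qed.

Lemma rmorph_cubic (R S : comNzRingType) (phi : {rmorphism R -> S}) (c : seq R) t :
  phi (cubic c t) = cubic (map phi c) (phi \o t).
Proof. by rewrite /cubic /= !(rmorphD, rmorphM) /= !nth_map_rmorph. Qed.

Lemma map_dcubic (R S : comNzRingType) (phi : {rmorphism R -> S}) i (c : seq R) :
  map phi (dcubic i c) = dcubic i (map phi c).
Proof.
have nat_phi n x : phi (n%:R * x) = n%:R * phi x by rewrite rmorphM rmorph_nat.
by rewrite /dcubic; case: (val i) => [|[|?]] /=; rewrite !nat_phi !nth_map_rmorph.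
Qed.

Lemma map_dquadric (R S : comNzRingType) (phi : {rmorphism R -> S}) i (c : seq R) :
  map phi (dquadric i c) = dquadric i (map phi c).
Proof.
have nat_phi n x : phi (n%:R * x) = n%:R * phi x by rewrite rmorphM rmorph_nat.
by rewrite /dquadric; case: (val i) => [|[|?]] /=; rewrite !nat_phi !nth_map_rmorph.
Qed.

Lemma rmorph_quadric (R S : comNzRingType) (phi : {rmorphism R -> S}) (c : seq R) t :
  phi (quadric c t) = quadric (map phi c) (phi \o t).
Proof. by rewrite /quadric /= !(rmorphD, rmorphM) /= !nth_map_rmorph. Qed.

Lemma rmorph_linear3 (R S : comNzRingType) (phi : {rmorphism R -> S}) (c : seq R) t :
  phi (linear3 c t) = linear3 (map phi c) (phi \o t).
Proof. by rewrite /linear3 /= !(rmorphD, rmorphM) /= !nth_map_rmorph. Qed.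

Lemma rmorph_deriv_at (R S : comNzRingType) (phi : {rmorphism R -> S}) (c : seq R) P Q :
  phi (deriv_at c P Q) = deriv_at (map phi c) (phi \o P) (phi \o Q).
Proof. by rewrite /deriv_at rmorph_linear3 /map !rmorph_quadric !map_dcubic. Qed.

Lemma rmorph_polar (R S : comNzRingType) (phi : {rmorphism R -> S}) (c : seq R) P Q W :
  phi (polar c P Q W) = polar (map phi c) (phi \o P) (phi \o Q) (phi \o W).
Proof.
rewrite /polar [LHS]rmorph_linear3 /map.
by congr (linear3 [:: _; _; _] _); rewrite rmorph_linear3 /map !rmorph_linear3 !map_dquadric !map_dcubic.
Qed.

Lemma map_csub (R S : comNzRingType) (phi : {rmorphism R -> S}) (c : seq R) A :
  map phi (csub c A) = csub (map phi c) (fun j i => phi (A j i)).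
Proof.
by congr [:: _; _; _; _; _; _; _; _; _; _];
  [exact: rmorph_cubic | exact: rmorph_deriv_at | exact: rmorph_deriv_at | exact: rmorph_deriv_at
  | exact: rmorph_polar | exact: rmorph_deriv_at | exact: rmorph_cubic | exact: rmorph_deriv_at
  | exact: rmorph_deriv_at | exact: rmorph_cubic].
Qed.

Lemma linform_linear3 a :
  linform a = linear3 [:: (a i0)%:MP; (a i1)%:MP; (a i2)%:MP] (fun i => 'X_i).
Proof. by rewrite /linform sum3 /linear3 /= !mul_mpolyC. Qed.

Lemma linform_lsub a (A : 'M[C]_3) :
  linform a \mPo lsub A = linform (fun i => \sum_j a j * A j i).
Proof.
rewrite /linform raddf_sum /=.
under eq_bigr => j _ do
  rewrite comp_mpolyZ comp_mpolyXU -tnth_nth tnth_mktuple /linform scaler_sumr.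
rewrite exchange_big; apply: eq_bigr => i _ /=.
by rewrite scaler_suml; apply: eq_bigr => j _; rewrite scalerA.
Qed.

Lemma linform_eq a b : a =1 b -> linform a = linform b.
Proof. by move=> ab; apply: eq_bigr => i _; rewrite ab. Qed.

Lemma lsub_mul (A B : 'M[C]_3) f : (f \mPo lsub A) \mPo lsub B = f \mPo lsub (A *m B).
Proof.
rewrite comp_mpolyA.
suff -> : [tuple tnth (lsub A) i \mPo lsub B | i < 3] = lsub (A *m B) by [].
apply: eq_from_tnth => j; rewrite !tnth_mktuple linform_lsub.
by apply: linform_eq => i; rewrite mxE.
Qed.

Lemma lsub1 f : f \mPo lsub 1%:M = f.
Proof.
rewrite -[RHS]comp_mpoly_id; suff -> : lsub 1%:M = [tuple 'X_i | i < 3] by [].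
apply: eq_from_tnth => j; rewrite !tnth_mktuple /linform (bigD1 j) //= big1 => [|i ij].
  by rewrite mxE eqxx scale1r addr0.
by rewrite mxE eq_sym (negPf ij) scale0r.
Qed.

Lemma completely_reducible_lsub (A : 'M[C]_3) f :
  completely_reducible f -> completely_reducible (f \mPo lsub A).
Proof.
move=> [a [b [c ->]]]; rewrite !rmorphM /= !linform_lsub.
by exists (fun i => \sum_j a j * A j i), (fun i => \sum_j b j * A j i), (fun i => \sum_j c j * A j i).
Qed.

(* The index [i2] encodes that Gamma is restricted to u = (0,0,1) in the new coordinates. *)
Definition gamma_vanishes (f : {mpoly C[3]}) :=
  forall A : 'M[C]_3, A \in unitmx -> gamma3 (fun i p => p^`M(i)) (f \mPo lsub A) 'X_i2 = 0.

(** The implication is packaged as one predicate so that a goal can be moved to new coordinates as a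
    whole. *)
Definition gamma_reducible (f : {mpoly C[3]}) := gamma_vanishes f -> completely_reducible f.

(** Invertible matrices are closed under products, so the hypothesis passes to the new coordinates;
    the factorization returns along the inverse of A. *)
Lemma gamma_reducible_lsub (A : 'M[C]_3) f :
  A \in unitmx -> gamma_reducible (f \mPo lsub A) -> gamma_reducible f.
Proof.
move=> uA redA vf; rewrite -(lsub1 f) -(mulmxV uA) -lsub_mul.
apply/completely_reducible_lsub/redA => B uB.
by rewrite lsub_mul; apply: vf; rewrite unitmx_mul uA.
Qed.

(** * Ternary cubics over C as coefficient lists *)

Definition cub (c : seq C) : {mpoly C[3]} := cubic (map (@mpolyC 3 C) c) (fun i => 'X_i).

Lemma nth_mpolyC (c : seq C) k : (map (@mpolyC 3 C) c)`_k = (c`_k)%:MP.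
Proof. exact: nth_map_rmorph. Qed.

Lemma cub_eq (c d : seq C) : (forall k, (k < 10)%N -> c`_k = d`_k) -> cub c = cub d.
Proof. by move=> cd; rewrite /cub /cubic !nth_mpolyC !cd. Qed.

Lemma det_det3 (A : 'M[C]_3) : \det A = det3 A.
Proof.
(* [C^o] is C as a module over itself, which turns the scaling in [sum_S3] into multiplication. *)
have := sum_S3 (fun i j k => A i0 i * A i1 j * A i2 k : C^o).
rewrite /det3 => <-; apply: eq_bigr => s _.
rewrite !big_ord_recl big_ord0 mulr1; congr (_ * _); rewrite mulrA.
have l1 : lift ord0 ord0 = i1 by apply: val_inj.
have l2 : lift ord0 (lift ord0 ord0) = i2 by apply: val_inj.
have l0 : ord0 = i0 by apply: val_inj.
by rewrite l1 l2 l0.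
Qed.

Lemma cub_lsub c (A : 'M[C]_3) : cub c \mPo lsub A = cub (csub c A).
Proof.
rewrite /cub (map_csub (@mpolyC 3 C)) -cubic_csub.
rewrite (rmorph_cubic (comp_mpoly (lsub A))).
rewrite /cubic /= !nth_map_rmorph /= !comp_mpolyC !comp_mpolyXU -!tnth_nth.
by rewrite !tnth_mktuple !linform_linear3.
Qed.

(** A is a plain function here, so that the entries of explicit matrices reduce by computation. *)
Lemma gamma_reducible_csub c (A : 'I_3 -> 'I_3 -> C) :
  det3 A != 0 -> gamma_reducible (cub (csub c A)) -> gamma_reducible (cub c).
Proof.
move=> dA; pose M := \matrix_(i, j) A i j.
have -> : csub c A = csub c M by rewrite /csub /deriv_at /polar /cubic /quadric /linear3 /= !mxE.
rewrite -cub_lsub; apply: gamma_reducible_lsub.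
by rewrite unitmxE det_det3 unitfE /det3 !mxE.
Qed.

Definition linform_prod (l m n : seq C) : seq C :=
  [:: l`_0 * m`_0 * n`_0;
      l`_0 * m`_0 * n`_1 + l`_0 * m`_1 * n`_0 + l`_1 * m`_0 * n`_0;
      l`_0 * m`_0 * n`_2 + l`_0 * m`_2 * n`_0 + l`_2 * m`_0 * n`_0;
      l`_0 * m`_1 * n`_1 + l`_1 * m`_0 * n`_1 + l`_1 * m`_1 * n`_0;
      l`_0 * (m`_1 * n`_2 + m`_2 * n`_1) + l`_1 * (m`_0 * n`_2 + m`_2 * n`_0)
        + l`_2 * (m`_0 * n`_1 + m`_1 * n`_0);
      l`_0 * m`_2 * n`_2 + l`_2 * m`_0 * n`_2 + l`_2 * m`_2 * n`_0;
      l`_1 * m`_1 * n`_1;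
      l`_1 * m`_1 * n`_2 + l`_1 * m`_2 * n`_1 + l`_2 * m`_1 * n`_1;
      l`_1 * m`_2 * n`_2 + l`_2 * m`_1 * n`_2 + l`_2 * m`_2 * n`_1;
      l`_2 * m`_2 * n`_2].

Lemma completely_reducible_cub c l m n :
  (forall k, (k < 10)%N -> c`_k = (linform_prod l m n)`_k) -> completely_reducible (cub c).
Proof.
move=> /cub_eq ->; exists (fun i => l`_i), (fun i => m`_i), (fun i => n`_i).
rewrite !linform_linear3 /cub /cubic /linform_prod /linear3 /= !(mpolyCD, mpolyCM).
by move: (_%:MP) (_%:MP) => *; ring.
Qed.

Lemma cubD (c d : seq C) : cub c + cub d = cub [seq c`_k + d`_k | k <- iota 0 10].
Proof. by rewrite /cub /cubic !nth_mpolyC /= !mpolyCD; ring. Qed.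

Lemma mpolyX_cub (k : C) (m : 'X_{1..3}) : mdeg m = 3%N -> exists c, k *: 'X_[m] = cub c.
Proof.
rewrite mdegE sum3 -mul_mpolyC mpolyXE_id => m3.
rewrite !big_ord_recl big_ord0 mulr1.
have -> : lift ord0 ord0 = i1 by apply: val_inj.
have -> : lift ord0 (lift ord0 ord0) = i2 by apply: val_inj.
have -> : ord0 = i0 by apply: val_inj.
(* The exponent triples are listed in the order of the coefficients of [cubic]; only the entry
   matching m is nonzero when k is. *)
exists [seq k * (t == (m i0, m i1, m i2))%:R | t <-
  [:: (3, 0, 0); (2, 1, 0); (2, 0, 1); (1, 2, 0); (1, 1, 1); (1, 0, 2);
      (0, 3, 0); (0, 2, 1); (0, 1, 2); (0, 0, 3)]%N].
rewrite /cub /cubic !nth_mpolyC /=.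
move: (m i0) (m i1) (m i2) m3 => [|[|[|[|a]]]] [|[|[|[|b]]]] [|[|[|[|c]]]] //= _;
by rewrite !(mulr0, mulr1, mpolyC0); ring.
Qed.

Lemma homog3_cub (f : {mpoly C[3]}) : f \is 3.-homog -> exists c, f = cub c.
Proof.
move=> /dhomogP hf; rewrite (mpolyE f) big_seq.
elim/big_ind: _ => [|p q [c ->] [d ->]|m /hf m3].
- by exists [::]; rewrite /cub /cubic /= !mul0r !addr0.
- by rewrite cubD; eexists.
- exact: mpolyX_cub.
Qed.

(** * Cubics with vanishing Gamma are completely reducible *)

Lemma mpoly_derivation3 : derivation3 (fun i (p : {mpoly C[3]}) => p^`M(i)).
Proof. by split=> [i p q|i p q]; [apply: mderivD | apply: mderivM]. Qed.

Lemma mpoly_coordinates3 : coordinates3 (fun i (p : {mpoly C[3]}) => p^`M(i)) (fun i => 'X_i).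
Proof.
move=> i j; have [->|ij] := eqVneq i j; first exact: mpolyX_deriv_self.
by rewrite mderivX mnm1E eq_sym (negPf ij) scale0r.
Qed.

Lemma linform_eq0 a i : linform a = 0 -> a i = 0.
Proof.
move=> /(congr1 (fun p => (p^`M(i))@_0)); rewrite linform_mderiv mderiv0.
by rewrite mcoeffC eqxx mulr1 mcoeff0.
Qed.

Lemma cub_triangle_gamma a b m p q c :
  gamma_vanishes (cub [:: 0; a; 0; b; m; p; 0; 0; q; c]) -> a != 0 -> b != 0 ->
  [/\ p = 0, q = 0 & c = 0].
Proof.
move=> /(_ _ (unitmx1 _ 3)); rewrite lsub1 /cub /= mpolyC0.
rewrite (gamma3_triangle mpoly_derivation3 mpoly_coordinates3) => [G0 a0 b0|i e]; last first.
  by rewrite !inE => /or4P[/eqP->|/eqP->|/eqP->|/or3P[]/eqP->]; apply: mderivC.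
have kE : 72%:R * 864%:R * (a%:MP * b%:MP) ^+ 2
    = (72%:R * 864%:R * (a * b) ^+ 2)%:MP :> {mpoly C[3]}.
  by rewrite !(mpolyCM, rmorphXn, mpolyC_nat).
have k0 : 72%:R * 864%:R * (a * b) ^+ 2 != 0 :> C.
  by rewrite !mulf_neq0 ?expf_neq0 ?mulf_neq0 ?pnatr_eq0.
have l0 : linform (point [:: p; q; c]) = 0.
  rewrite linform_linear3 /linear3 /=; apply/eqP; move: G0 => /eqP.
  by rewrite kE mul_mpolyC scaler_eq0 (negPf k0).
by split; [have := linform_eq0 i0 l0 | have := linform_eq0 i1 l0 | have := linform_eq0 i2 l0].
Qed.

Lemma gamma_reducible_triangle c :
  c`_0 = 0 -> c`_2 = 0 -> c`_6 = 0 -> c`_7 = 0 -> c`_1 != 0 -> c`_3 != 0 ->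
  gamma_reducible (cub c).
Proof.
move=> c0 c2 c6 c7 c1 c3.
have -> : cub c = cub [:: 0; c`_1; 0; c`_3; c`_4; c`_5; 0; 0; c`_8; c`_9].
  by apply: cub_eq; do 10?[case=> [_|] /=; first by rewrite ?c0 ?c2 ?c6 ?c7].
move=> /cub_triangle_gamma /(_ c1 c3)[-> -> ->].
(* What is left is xy(ax + by + mz). *)
apply: (@completely_reducible_cub _ [:: 1; 0; 0] [:: 0; 1; 0] [:: c`_1; c`_3; c`_4]).
by do 10?[case=> [_|] /=; first by ring].
Qed.

(** On z = 0 the cubic is xy(c_1 x + c_3 y), with three distinct zeros. Adding multiples of z to x
    and y removes the terms y^2 z and x^2 z. *)
Lemma gamma_reducible_three_points c :
  c`_0 = 0 -> c`_6 = 0 -> c`_1 != 0 -> c`_3 != 0 -> gamma_reducible (cub c).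
Proof.
move=> c0 c6 c1 c3.
pose A (j i : 'I_3) : C := (nth [::] [:: [:: 1; 0; - c`_7 / c`_3]; [:: 0; 1; - c`_2 / c`_1]; [:: 0; 0; 1]] j)`_i.
apply: (@gamma_reducible_csub _ A); first by rewrite /det3 /A /= !(mulr0, mul0r, mulr1, subr0, addr0) oner_neq0.
apply: gamma_reducible_triangle;
  rewrite /= /cubic /deriv_at /linear3 /quadric /dcubic /A /= ?c0 ?c6;
  move: c1 c3; move: (c`_1) (c`_2) (c`_3) (c`_4) (c`_5) (c`_7) (c`_8) (c`_9) => a1 a2 a3 a4 a5 a7 a8 a9 a1n a3n.
all: try by field; rewrite ?a1n ?a3n.
  by rewrite (_ : _ + _ = a1) //; ring.
by rewrite (_ : _ + _ = a3) //; ring.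
Qed.

(** On the line z = t y the cubic is y (c_2 t x^2 + q xy + k y^2). A nonzero discriminant and c_2 t
    != 0 make its three zeros distinct. *)
Lemma gamma_reducible_smooth_point_line c t :
  c`_0 = 0 -> c`_1 = 0 -> c`_2 != 0 -> t != 0 ->
  let k := c`_6 + c`_7 * t + c`_8 * t ^+ 2 + c`_9 * t ^+ 3 in
  let q := c`_3 + c`_4 * t + c`_5 * t ^+ 2 in
  q ^+ 2 - 4%:R * c`_2 * t * k != 0 ->
  gamma_reducible (cub c).
Proof.
move=> c0 c1 c2 t0 k q disc; have ct0 : c`_2 * t != 0 by rewrite mulf_neq0.
have [s Es] := quadratic_root q k ct0.
(* The first two columns are the zeros (s,1,t) and (1,0,0), which span the line z = t y. *)
pose A (j i : 'I_3) : C := (nth [::] [:: [:: s; 1; 0]; [:: 1; 0; 0]; [:: t; 0; 1]] j)`_i.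
apply: (@gamma_reducible_csub _ A); first by rewrite /det3 /A /= !(mulr0, mul0r, mulr1, subr0, addr0, sub0r, mul1r) oppr_eq0 oner_neq0.
(* The square of the derivative of a quadratic at a root is its discriminant. *)
have slope : 2%:R * (c`_2 * t) * s + q != 0.
  apply: contraNneq disc => slope.
  have -> : q ^+ 2 - 4%:R * c`_2 * t * k = (2%:R * (c`_2 * t) * s + q) ^+ 2
      - 4%:R * (c`_2 * t) * (c`_2 * t * s ^+ 2 + q * s + k) by ring.
  by rewrite slope Es; apply/eqP; ring.
rewrite /k /q in Es slope; move: {disc k q} Es slope ct0 => Es slope ct0.
apply: gamma_reducible_three_points;
  rewrite /= /cubic /deriv_at /linear3 /quadric /dcubic /A /= ?c0 ?c1;
  move: (c`_2) (c`_3) (c`_4) (c`_5) (c`_6) (c`_7) (c`_8) (c`_9) Es slope ct0 => a2 a3 a4 a5 a6 a7 a8 a9 Es slope ct0.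
- by rewrite -[RHS]Es; ring.
- by ring.
- by rewrite (_ : _ + _ = 2%:R * (a2 * t) * s + (a3 + a4 * t + a5 * t ^+ 2)) //; ring.
- by rewrite (_ : _ + _ = a2 * t) //; ring.
Qed.

(** A quartic with five distinct zeros vanishes. The points avoid 0, for which the line z = t y
    would be the tangent. *)
Lemma quartic_coef_eq0 (F : numFieldType) (d0 d1 d2 d3 d4 : F) :
  {in [:: 1; -1; 2%:R; - 2%:R; 3%:R],
    forall t, d0 + d1 * t + d2 * t ^+ 2 + d3 * t ^+ 3 + d4 * t ^+ 4 = 0} ->
  [/\ d0 = 0, d1 = 0, d2 = 0, d3 = 0 & d4 = 0].
Proof.
move=> d; pose e t := d0 + d1 * t + d2 * t ^+ 2 + d3 * t ^+ 3 + d4 * t ^+ 4.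
have e1 : e 1 = 0 by apply: d; rewrite !inE eqxx ?orbT.
have e2 : e (-1) = 0 by apply: d; rewrite !inE eqxx ?orbT.
have e3 : e 2%:R = 0 by apply: d; rewrite !inE eqxx ?orbT.
have e4 : e (- 2%:R) = 0 by apply: d; rewrite !inE eqxx ?orbT.
have e5 : e 3%:R = 0 by apply: d; rewrite !inE eqxx ?orbT.
(* Lagrange interpolation at the five points *)
have E0 : d0 = e 1 + e (-1) / 2%:R - e 2%:R / 2%:R - e (- 2%:R) / 10%:R + e 3%:R / 10%:R.
  by rewrite /e; field.
have E1 : d1 = (8%:R * e 1 - 8%:R * e (-1) - e 2%:R + e (- 2%:R)) / 12%:R by rewrite /e; field.
have E2 : d2 = (14%:R * e 2%:R + e (-1) + 2%:R * e (- 2%:R) - 14%:R * e 1 - 3%:R * e 3%:R) / 24%:R.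
  by rewrite /e; field.
have E3 : d3 = (2%:R * e (-1) - 2%:R * e 1 + e 2%:R - e (- 2%:R)) / 12%:R by rewrite /e; field.
have E4 : d4 = (10%:R * e 1 - 5%:R * e (-1) - 10%:R * e 2%:R + 2%:R * e (- 2%:R) + 3%:R * e 3%:R) / 120%:R.
  by rewrite /e; field.
by rewrite E0 E1 E2 E3 E4 e1 e2 e3 e4 e5; split; ring.
Qed.

Lemma gamma_reducible_tangent c :
  c`_0 = 0 -> c`_1 = 0 -> c`_2 != 0 -> gamma_reducible (cub c).
Proof.
move=> c0 c1 c2.
pose k t := c`_6 + c`_7 * t + c`_8 * t ^+ 2 + c`_9 * t ^+ 3.
pose q t := c`_3 + c`_4 * t + c`_5 * t ^+ 2.
pose disc t := q t ^+ 2 - 4%:R * c`_2 * t * k t.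
have [/allP disc0 | /allPn[t tI disct]] :=
  boolP (all (fun t => disc t == 0) [:: 1; -1; 2%:R; - 2%:R; 3%:R]); last first.
  apply: (@gamma_reducible_smooth_point_line _ t) => //; move: tI.
  by rewrite !inE => /or4P[/eqP->|/eqP->|/eqP->|/orP[]/eqP->]; rewrite ?oppr_eq0 ?oner_neq0 ?pnatr_eq0.
have [d0 d1 d2 d3 d4] : [/\ c`_3 ^+ 2 = 0, 2%:R * c`_3 * c`_4 - 4%:R * c`_2 * c`_6 = 0,
    c`_4 ^+ 2 + 2%:R * c`_3 * c`_5 - 4%:R * c`_2 * c`_7 = 0,
    2%:R * c`_4 * c`_5 - 4%:R * c`_2 * c`_8 = 0 & c`_5 ^+ 2 - 4%:R * c`_2 * c`_9 = 0].
  apply: quartic_coef_eq0 => t /disc0/eqP; rewrite /disc /q /k => E; rewrite -[RHS]E; ring.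
have c3 : c`_3 = 0 by apply/eqP; rewrite -sqrf_eq0 d0.
have solve x y : y - 4%:R * c`_2 * x = 0 -> x = y / (4%:R * c`_2).
  by move=> /eqP; rewrite subr_eq0 => /eqP ->; field.
have c6 : c`_6 = 0 by rewrite (solve _ _ d1) c3 mulr0 !mul0r.
have c7 := solve _ _ d2; have c8 := solve _ _ d3; have c9 := solve _ _ d4.
(* Now q = z (c_4 y + c_5 z) and 4 c_2 k = z (c_4 y + c_5 z)^2. Completing the square gives f = c_2
   z (x + (c_4 y + c_5 z) / (2 c_2))^2. *)
move=> _; pose l := [:: 1; c`_4 / (2%:R * c`_2); c`_5 / (2%:R * c`_2)].
apply: (@completely_reducible_cub _ [:: 0; 0; c`_2] l l).
case=> [|[|[|[|[|[|[|[|[|[|//]]]]]]]]]] _ /=;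
  rewrite ?c0 ?c1 ?c6 ?c7 ?c8 ?c9 ?c3; by field.
Qed.

(** The tangent at (1,0,0) is c_1 y + c_2 z = 0. It becomes z = 0 after exchanging y and z if c_2 =
    0, and after a shear of z by y otherwise. *)
Lemma gamma_reducible_smooth c :
  c`_0 = 0 -> c`_1 != 0 \/ c`_2 != 0 -> gamma_reducible (cub c).
Proof.
move=> c0 c12; have [c2 | c2] := eqVneq c`_2 0.
  have c1 : c`_1 != 0 by case: c12 => //; rewrite c2 eqxx.
  pose A (j i : 'I_3) : C := (nth [::] [:: [:: 1; 0; 0]; [:: 0; 0; 1]; [:: 0; 1; 0]] j)`_i.
  apply: (@gamma_reducible_csub _ A).
    by rewrite (_ : det3 A = -1) ?oppr_eq0 ?oner_neq0 // /det3 /A /=; ring.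
  by apply: gamma_reducible_tangent; rewrite /= /cubic /deriv_at /linear3 /quadric /dcubic /A /= ?c0 ?c2;
    [ring | ring | rewrite (_ : _ + _ = c`_1) //; ring].
pose A (j i : 'I_3) : C := (nth [::] [:: [:: 1; 0; 0]; [:: 0; 1; 0]; [:: 0; - c`_1 / c`_2; 1]] j)`_i.
apply: (@gamma_reducible_csub _ A).
  by rewrite (_ : det3 A = 1) ?oner_neq0 // /det3 /A /=; ring.
by apply: gamma_reducible_tangent; rewrite /= /cubic /deriv_at /linear3 /quadric /dcubic /A /= ?c0;
  [ring | field | rewrite (_ : _ + _ = c`_2) //; ring].
Qed.

Lemma completely_reducible_binary c :
  c`_0 = 0 -> c`_1 = 0 -> c`_2 = 0 -> c`_3 = 0 -> c`_4 = 0 -> c`_5 = 0 ->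
  completely_reducible (cub c).
Proof.
move=> c0 c1 c2 c3 c4 c5; have [c6 | c6] := eqVneq c`_6 0.
  have [p [q [r [s [E7 E8 E9]]]]] := quadratic_split c`_7 c`_8 c`_9.
  apply: (@completely_reducible_cub _ [:: 0; 0; 1] [:: 0; p; q] [:: 0; r; s]).
  case=> [|[|[|[|[|[|[|[|[|[|//]]]]]]]]]] _ /=;
    rewrite ?c0 ?c1 ?c2 ?c3 ?c4 ?c5 ?c6 ?E7 ?E8 ?E9; by ring.
have [u Eu] := cubic_root c`_7 c`_8 c`_9 c6.
(* These are the coefficients of the quotient of the binary cubic by y - u z, from synthetic
   division. *)
have [p [q [r [s [E7 E8 E9]]]]] :=
  quadratic_split c`_6 (c`_7 + c`_6 * u) (c`_8 + c`_7 * u + c`_6 * u ^+ 2).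
have {}E8 : c`_7 = p * s + q * r - p * r * u by rewrite -E8 -E7; ring.
have {}E9 : c`_8 = q * s - (p * s + q * r) * u by rewrite -E9 E8 E7; ring.
have E10 : c`_9 = - (q * s * u) by apply/eqP; rewrite -subr_eq0; apply/eqP; rewrite -[RHS]Eu E9 E8 E7; ring.
apply: (@completely_reducible_cub _ [:: 0; 1; - u] [:: 0; p; q] [:: 0; r; s]).
case=> [|[|[|[|[|[|[|[|[|[|//]]]]]]]]]] _ /=;
  rewrite ?c0 ?c1 ?c2 ?c3 ?c4 ?c5 ?E7 ?E8 ?E9 ?E10; by ring.
Qed.

(** If (1,0,0) is singular, then f = x q(y,z) + k(y,z). Wherever q is nonzero, x = - k / q is a zero
    whose x-derivative is q, hence smooth. It is enough to try (y,z) = (1,0), (0,1) and (1,1);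
    otherwise q = 0 and f is binary. *)
Lemma gamma_reducible_point c : c`_0 = 0 -> gamma_reducible (cub c).
Proof.
move=> c0; have [c1 | c1] := eqVneq c`_1 0; last by apply: gamma_reducible_smooth => //; left.
have [c2 | c2] := eqVneq c`_2 0; last by apply: gamma_reducible_smooth => //; right.
have [c3 | c3] := eqVneq c`_3 0; last first.
  pose A (j i : 'I_3) : C := (nth [::] [:: [:: - c`_6 / c`_3; 1; 0]; [:: 1; 0; 0]; [:: 0; 0; 1]] j)`_i.
  apply: (@gamma_reducible_csub _ A).
    by rewrite (_ : det3 A = -1) ?oppr_eq0 ?oner_neq0 // /det3 /A /=; ring.
  apply: gamma_reducible_smooth; [|left];
    rewrite /= /cubic /deriv_at /linear3 /quadric /dcubic /A /= ?c0 ?c1 ?c2.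
    by field.
  by rewrite (_ : _ + _ = c`_3) //; field.
have [c5 | c5] := eqVneq c`_5 0; last first.
  pose A (j i : 'I_3) : C := (nth [::] [:: [:: - c`_9 / c`_5; 1; 0]; [:: 0; 0; 1]; [:: 1; 0; 0]] j)`_i.
  apply: (@gamma_reducible_csub _ A).
    by rewrite (_ : det3 A = 1) ?oner_neq0 // /det3 /A /=; ring.
  apply: gamma_reducible_smooth; [|left];
    rewrite /= /cubic /deriv_at /linear3 /quadric /dcubic /A /= ?c0 ?c1 ?c2.
    by field.
  by rewrite (_ : _ + _ = c`_5) //; field.
have [c4 | c4] := eqVneq c`_4 0; first by move=> _; apply: completely_reducible_binary.
pose A (j i : 'I_3) : C :=
  (nth [::] [:: [:: - (c`_6 + c`_7 + c`_8 + c`_9) / c`_4; 1; 0]; [:: 1; 0; 0]; [:: 1; 0; 1]] j)`_i.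
apply: (@gamma_reducible_csub _ A).
  by rewrite (_ : det3 A = -1) ?oppr_eq0 ?oner_neq0 // /det3 /A /=; ring.
apply: gamma_reducible_smooth; [|left];
  rewrite /= /cubic /deriv_at /linear3 /quadric /dcubic /A /= ?c0 ?c1 ?c2 ?c3 ?c5.
  by field.
by rewrite [X in X != _](_ : _ = c`_4) //; field.
Qed.

(** If (1,0,0) is not a zero, the line z = 0 contains a zero (r,1,0), which is moved to (1,0,0). *)
Lemma gamma_reducible_cub c : gamma_reducible (cub c).
Proof.
have [c0 | c0] := eqVneq c`_0 0; first exact: gamma_reducible_point.
have [r Er] := cubic_root c`_1 c`_3 c`_6 c0.
pose A (j i : 'I_3) : C := (nth [::] [:: [:: r; 1; 0]; [:: 1; 0; 0]; [:: 0; 0; 1]] j)`_i.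
apply: (@gamma_reducible_csub _ A).
  by rewrite (_ : det3 A = -1) ?oppr_eq0 ?oner_neq0 // /det3 /A /=; ring.
apply: gamma_reducible_point; rewrite /= /cubic /A /= -[RHS]Er; ring.
Qed.

(** * Covariants of completely reducible cubics *)

(** The matrix of second derivatives is M^T N M, where M has rows a, b, c and N is symmetric with
    zero diagonal and entries r, q, p above it. As det N = 2pqr, the factor is 6 * 2 = 12. *)
Lemma hessian_linear_product (R : comNzRingType) (D : 'I_3 -> R -> R) (p q r : R) (a b c : 'I_3 -> R) :
  derivation3 D -> (forall i, D i p = a i) -> (forall i, D i q = b i) -> (forall i, D i r = c i) ->
  (forall i j, [/\ D i (a j) = 0, D i (b j) = 0 & D i (c j) = 0]) ->
  trv D 2 (p * q * r) (p * q * r) (p * q * r)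
   = 12%:R * det3 (fun i => match val i with 0 => a | 1 => b | _ => c end) ^+ 2 * (p * q * r).
Proof.
move=> [DD DM] Dp Dq Dr Dabc.
pose h i j := (a i * b j + b i * a j) * r + (a i * c j + c i * a j) * q + (b i * c j + c i * b j) * p.
have fh i j : D i (D j (p * q * r)) = h i j.
  have [Da Db Dc] := Dabc i j.
  by rewrite !(DM, DD, Dp, Dq, Dr, Da, Db, Dc) /h; ring.
rewrite (trv2_hessian fh) => [|i j]; last by rewrite /h; ring.
by rewrite /det3 /h /=; ring.
Qed.

Lemma embx_linform a : embx (linform a) = \sum_(j < 3) a j *: 'X_(xv j).
Proof.
rewrite /embx /linform raddf_sum /=; apply: eq_bigr => j _.
by rewrite comp_mpolyZ comp_mpolyXU -tnth_nth tnth_mktuple.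
Qed.

Lemma embx_linform_mderiv a i : (embx (linform a))^`M(xv i) = (a i)%:MP.
Proof.
rewrite embx_linform raddf_sum (bigD1 i) //= big1 => [|j ji].
  by rewrite mderivZ mpolyX_deriv_self addr0 alg_mpolyC.
by rewrite mderivZ mderivX mnm1E (inj_eq (@lshift_inj 3 3)) (negPf ji) scale0r scaler0.
Qed.

Lemma completely_reducible_Hess f :
  completely_reducible f -> exists lambda : C, Hess (embx f) = lambda *: embx f.
Proof.
move=> [a [b [c ->]]].
pose D i (p : {mpoly C[6]}) := p^`M(xv i).
have dD : derivation3 D by split=> [i p q|i p q]; [apply: mderivD | apply: mderivM].
pose l : {mpoly C[6]} := embx (linform a); pose m : {mpoly C[6]} := embx (linform b).
pose n : {mpoly C[6]} := embx (linform c).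
have -> : embx (linform a * linform b * linform c) = l * m * n by rewrite /embx !rmorphM.
exists (det3 (fun i => match val i with 0 => a | 1 => b | _ => c end) ^+ 2).
rewrite /Hess transvectantE.
rewrite (hessian_linear_product (a := fun i => (a i)%:MP) (b := fun i => (b i)%:MP)
  (c := fun i => (c i)%:MP) dD) //; try exact: embx_linform_mderiv; last first.
  by move=> i j; split; apply: mderivC.
move: (l * m * n) => p; rewrite -!mul_mpolyC [LHS]mulrA; congr (_ * p).
rewrite mulrA -mpolyC_nat -mpolyCM mulVf ?pnatr_eq0 // mul1r rmorphXn /=.
by rewrite /det3 /= !(mpolyCD, mpolyCB, mpolyCM, mpolyCN).
Qed.

Lemma Hess_PiCov F (lambda : C) : Hess F = lambda *: F -> PiCov F = 0.
Proof.
move=> HF; rewrite /PiCov HF transvectantE /= !mderivZ -!mul_mpolyC.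
rewrite [X in _ * X](_ : _ = 0) ?mulr0 //.
move: (F^`M(xv i0)) (F^`M(xv i1)) (F^`M(xv i2)) (ux^`M(xv i0)) (ux^`M(xv i1)) (ux^`M(xv i2)).
by move: (lambda%:MP) => *; ring.
Qed.

Lemma PiCov_GammaCov F : PiCov F = 0 -> GammaCov F = 0.
Proof.
move=> PF; rewrite /GammaCov PF transvectantE.
(* Writing 0 as 0 * 0 lets the constant 0 be pulled out of the first argument. *)
by rewrite -(mul0r (0 : {mpoly C[6]})) trv_scale1 ?mul0r ?scaler0 //;
  [move=> i p q; apply: mderivD | move=> i p; rewrite !mul0r mderiv0].
Qed.

Theorem theorem8p2 (f : {mpoly C[3]}) (hf : f \is 3.-homog) :
  [/\ completely_reducible f <-> (exists lambda : C, Hess (embx f) = lambda *: embx f),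
      completely_reducible f <-> PiCov (embx f) = 0
    & completely_reducible f <-> GammaCov (embx f) = 0].
Proof.
have hess := @completely_reducible_Hess f.
have pi : (exists lambda : C, Hess (embx f) = lambda *: embx f) -> PiCov (embx f) = 0.
  by move=> [lambda /Hess_PiCov].
have gamma := @PiCov_GammaCov (embx f).
have red : GammaCov (embx f) = 0 -> completely_reducible f.
  move=> G0; have [c Ef] := homog3_cub hf; rewrite Ef.
  by apply: gamma_reducible_cub => A uA; apply: gamma3_lsub; rewrite -?Ef.
by split; split; auto.
Qed.
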